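(* The distributionally robust optimization problem $$\min_{\mathbf{x} \in X} \max_{\mathbb{Q} \in \widehat{\mathcal{Q}}} \mathbb{E}_{\mathbb{Q}}\{\mathbf{c}^\top \mathbf{x}\}$$ is equivalent (same optimal value and same optimal decisions $\mathbf{x}$) to the minimization problem $$\min_{\mathbf{x} \in X} \sum_{a \in \mathcal{A}} \min_{\beta_a \geq \overline{z}_a} \Big( \beta_a - e^{-r_a}\prod_{i = 1}^{d_a} (\beta_a - z_{a,i})^{\widehat{q}_{a,i}} \Big) x_a,$$ where $\overline{z}_a = \max_{i \in \{1, \ldots, d_a\}} z_{a,i}$ for each $a \in \mathcal{A}$.
   Context: Let $n = n_1 + n_2$, $\mathcal{A} = \{1,\ldots,n\}$, and let $X \subseteq \mathbb{Z}^{n_1}\times\mathbb{R}^{n_2}$ be a nonempty linear mixed-integer set (the points of $\mathbb{Z}^{n_1}\times\mathbb{R}^{n_2}$ satisfying a finite system of linear constraints) such that $\mathbf{0}\notin X$ and there is $\mathbf{u}\in\mathbb{R}^n_+$ with $x_a\in[0,u_a]$ for all $a\in\mathcal{A}$ and all $\mathbf{x}\in X$. For each $a\in\mathcal{A}$, the cost $c_a$ takes values in a finite set $\mathcal{S}_a=\{z_{a,1},\ldots,z_{a,d_a}\}$ of $d_a$ strictly positive reals. $\mathcal{Q}_0(\mathcal{S})$ denotes the set of all probability distributions supported on $\mathcal{S}$. A distribution $\mathbb{Q}_a\in\mathcal{Q}_0(\mathcal{S}_a)$ is identified with $(q_{a,1},\ldots,q_{a,d_a})$, where $q_{a,i}$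 is the probability that $c_a=z_{a,i}$. For a joint distribution $\mathbb{Q}$ of $\mathbf{c}=(c_1,\ldots,c_n)^\top$ on $\mathcal{S}_1\times\cdots\times\mathcal{S}_n$, $\mathbb{Q}_a$ denotes its $a$-th marginal. For each $a$, a data sample $\widehat{c}_{a,1},\ldots,\widehat{c}_{a,T_a}\in\mathcal{S}_a$ of size $T_a\in\mathbb{Z}_{>0}$ is given, and the empirical marginal distribution $\widehat{\mathbb{Q}}_{a,T_a}$ has probabilities $\widehat{q}_{a,i}=\frac{1}{T_a}\#\{j\in\{1,\ldots,T_a\}:\widehat{c}_{a,j}=z_{a,i}\}$. The relative entropy distance is $D_{KL}(\widehat{\mathbb{Q}}_{a,T_a}\Vert\mathbb{Q}_a)=\sum_{i=1}^{d_a}\widehat{q}_{a,i}\ln\frac{\widehat{q}_{a,i}}{q_{a,i}}$, with the conventions $0\ln(0/q)=0$ for $q\ge 0$ and $q'\ln(q'/0)=\infty$ for $q'>0$; also $0^0=1$. Given radii $r_a\in\mathbb{R}_{>0}$, $a\in\mathcal{A}$, define $$\widehat{\mathcal{Q}}_a=\{\mathbb{Q}_a\in\mathcal{Q}_0(\mathcal{S}_a): D_{KL}(\widehat{\mathbb{Q}}_{a,T_a}\Vert\mathbb{Q}_a)\le r_a\},\qquad \widehat{\mathcal{Q}}=\{\mathbb{Q}\in\mathcal{Q}_0(\mathcal{S}_1\times\cdots\times\mathcal{S}_n):\mathbb{Q}_a\in\widehat{\mathcal{Q}}_a\ \forall a\in\mathcal{A}\}.$$ *)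

(* Defs.v *)
From HB Require Import structures.
From mathcomp Require Import all_boot all_order all_algebra.
From mathcomp Require Import all_classical all_reals all_analysis.

Set Implicit Arguments.
Unset Strict Implicit.
Unset Printing Implicit Defensive.

Import Order.TTheory GRing.Theory Num.Theory.

Local Open Scope classical_set_scope.
Local Open Scope ring_scope.

Definition is_min {R : realType} (E : set R) (v : R) : Prop := E v /\ lbound E v.

Definition is_max {R : realType} (E : set R) (v : R) : Prop := E v /\ ubound E v.

Definition argmin {R : realType} {U : Type} (X : set U) (f : U -> R) : set U :=
  [set x | X x /\ forall y, X y -> f x <= f y].

(* The points of Z^n1 x R^n2 satisfying A x <= b; an equality constraint is
   encoded by two opposite rows. *)
Definition mixed_integer_set {R : realType} (n1 n2 m : nat)
    (A : 'M[R]_(m, n1 + n2)) (b : 'cV[R]_m) : set 'cV[R]_(n1 + n2) :=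
  [set x : 'cV[R]_(n1 + n2) |
    (forall i : 'I_n1, x (lshift n2 i) 0 \is a Num.int) /\
    (forall k : 'I_m, (A *m x) k 0 <= b k 0)].

(* The probability distributions on a finite type, given by their mass
   functions. *)
Definition distributions {R : realType} (S : finType) : set (S -> R) :=
  [set q | (forall s, 0 <= q s) /\ \sum_s q s = 1].

(* The conventions 0 ln (0 / q) = 0 and q' ln (q' / 0) = +oo are spelled out,
   as division and ln are total functions on R. *)
Definition KL_div {R : realType} (S : finType) (q' q : S -> R) : \bar R :=
  (\sum_s (if q' s == 0%R then 0
           else if q s == 0%R then +oo
           else (q' s * ln (q' s / q s))%:E))%E.

Section Model.
Context {R : realType} {n : nat}.
(* The support S_a of the a-th cost is {z a i | i < d a}; a distribution on S_a
   is a mass function on the indices 'I_(d a), and one on S_1 x ... x S_n is a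
   mass function on [scenario]. These identifications require z a to be
   injective, as is assumed in the theorem. *)
Context {d : 'I_n -> nat}.
Variable z : forall a : 'I_n, 'I_(d a) -> R.

Definition scenario : finType := {dffun forall a : 'I_n, 'I_(d a)}.

Definition marginal (Q : scenario -> R) (a : 'I_n) : 'I_(d a) -> R :=
  fun i => \sum_(s : scenario | s a == i) Q s.

Definition expected_cost (Q : scenario -> R) (x : 'cV[R]_n) : R :=
  \sum_(s : scenario) Q s * \sum_(a < n) z (s a) * x a 0.

Variables (T : 'I_n -> nat) (chat : forall a : 'I_n, 'I_(T a) -> R).
Variable r : 'I_n -> R.

Definition empirical (a : 'I_n) : 'I_(d a) -> R :=
  fun i => #|[pred j : 'I_(T a) | chat j == z i]|%:R / (T a)%:R.

Definition marginal_ambiguity_set (a : 'I_n) : set ('I_(d a) -> R) :=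
  [set q | distributions q /\ (KL_div (@empirical a) q <= (r a)%:E)%E].

Definition ambiguity_set : set (scenario -> R) :=
  [set Q | distributions Q /\
           forall a : 'I_n, marginal_ambiguity_set (@marginal Q a)].

Definition expected_costs (x : 'cV[R]_n) : set R :=
  [set expected_cost Q x | Q in ambiguity_set].

(* The maximum of [expected_costs x], once it is known to be attained. *)
Definition worst_case_cost (x : 'cV[R]_n) : R := sup (expected_costs x).

(* The default value 0 is harmless since the z a i are positive. *)
Definition zbar (a : 'I_n) : R := \big[Num.max/0]_(i < d a) z i.

Definition dual_function (a : 'I_n) (beta : R) : R :=
  beta - expR (- r a) * \prod_(i < d a) (beta - z i) `^ (@empirical a i).

Definition dual_values (a : 'I_n) : set R :=
  [set dual_function a beta | beta in [set beta | zbar a <= beta]].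

(* The minimum of [dual_values a], once it is known to be attained. *)
Definition dual_min (a : 'I_n) : R := inf (dual_values a).

Definition reformulated_cost (x : 'cV[R]_n) : R :=
  \sum_(a < n) dual_min a * x a 0.

End Model.

(* Main.v *)
(* The expected cost depends on the joint distribution only through its marginals,
   and any choice of marginals is realized by the product distribution. Since
   x >= 0, the worst case splits into one problem per coordinate: maximize
   \sum_i q i * z i over the q with KL_div p q <= r, where p is the empirical
   marginal. If beta bounds every z i, weighted AM-GM gives
     beta - \sum_i q i * z i = \sum_i q i * (beta - z i)
       >= \prod_i (q i * (beta - z i) / p i) `^ p i
       >= e^-r * \prod_i (beta - z i) `^ p i,
   with equality when q i is proportional to p i / (beta - z i) and the KL
   constraint is tight. The intermediate value theorem yields such a beta, unless
   the constraint is slack for all beta; then beta = max z, and the missing mass of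
   q sits on the largest z i. The minimum over X is attained because X is compact. *)

Require Import Defs.
From HB Require Import structures.
From mathcomp Require Import all_boot all_order all_algebra.
From mathcomp Require Import all_classical all_reals all_analysis.
From mathcomp Require Import ring lra.

Set Implicit Arguments.
Unset Strict Implicit.
Unset Printing Implicit Defensive.

Import Order.TTheory GRing.Theory Num.Theory.
Import numFieldNormedType.Exports.

Local Open Scope classical_set_scope.
Local Open Scope ring_scope.

(** * Duality for a single cost with finite support *)

Section OneDimensionalDuality.
Context {R : realType} {S : finType}.
Implicit Types p q x z : S -> R.

(** Positivity matters only on the support of [p]: elsewhere both factors are 1. *)
Lemma prod_powR p x : (forall i, p i != 0 -> 0 < x i) ->
  \prod_i x i `^ p i = expR (\sum_i p i * ln (x i)).
Proof.
move=> x_gt0; rewrite expR_sum; apply: eq_bigr => i _.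
have [->|pi0] := eqVneq (p i) 0; first by rewrite powRr0 mul0r expR0.
by rewrite /powR gt_eqF ?x_gt0.
Qed.

Lemma distribution_neq0 p : distributions p -> exists i, p i != 0.
Proof.
move=> [_ p1]; apply: contrapT => /forallNP p0; have /eqP := p1.
by rewrite big1 ?(eq_sym 0) ?oner_eq0// => i _; have /negP/negPn/eqP := p0 i.
Qed.

(** Average over [p] the tangent bound for [ln] at the weighted mean [M]. A zero [x i] on the
    support makes the product vanish. *)
Lemma weighted_AMGM p x : distributions p -> (forall i, 0 <= x i) ->
  \prod_i x i `^ p i <= \sum_i p i * x i.
Proof.
move=> dp x_ge0; have [p_ge0 p1] := dp.
have [[i pi0 xi0]|supp] := pselect (exists2 i, p i != 0 & x i = 0).
  rewrite (bigD1 i)//= xi0 powR0// mul0r.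
  by apply: sumr_ge0 => j _; exact: mulr_ge0.
have x_gt0 i : p i != 0 -> 0 < x i.
  move=> pi0; rewrite lt_neqAle x_ge0 andbT eq_sym; apply/eqP => xi0.
  by apply: supp; exists i.
have M_gt0 : 0 < \sum_i p i * x i.
  have [i pi0] := distribution_neq0 dp; rewrite (bigD1 i)//= ltr_pwDl//.
    by rewrite mulr_gt0 ?x_gt0// lt_neqAle eq_sym pi0 p_ge0.
  by apply: sumr_ge0 => j _; exact: mulr_ge0.
set M := \sum_i _ in M_gt0 *.
rewrite prod_powR// -[leRHS]lnK ?posrE// ler_expR.
have ln_tangent i : p i * ln (x i) <= p i * (ln M + x i / M - 1).
  have [->|pi0] := eqVneq (p i) 0; first by rewrite !mul0r.
  rewrite ler_wpM2l//.
  have xM : 0 < x i / M by rewrite divr_gt0// x_gt0.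
  have := @le_ln1Dx R (x i / M - 1); rewrite subrKC ltrBrDl addrN => /(_ xM).
  by rewrite ln_div ?posrE ?x_gt0//; lra.
apply: (le_trans (ler_sum _ (fun i _ => ln_tangent i))).
under eq_bigr do rewrite -addrA mulrDr.
rewrite big_split/= -mulr_suml p1 mul1r gerDl.
under eq_bigr do rewrite mulrBr mulr1 mulrA.
by rewrite sumrB -mulr_suml -/M p1 divff ?subrr// gt_eqF.
Qed.

Lemma KL_div_fin p q : (forall i, p i != 0 -> q i != 0) ->
  KL_div p q = (\sum_i p i * ln (p i / q i))%:E.
Proof.
move=> pq; rewrite /KL_div -sumEFin; apply: eq_bigr => i _.
have [->|/pq/negbTE->//] := eqVneq (p i) 0.
by rewrite mul0r.
Qed.

(** A zero [q i] with [p i] nonzero contributes +oo, and no term is -oo to offset it. *)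
Lemma KL_div_lty p q : (KL_div p q < +oo)%E -> forall i, p i != 0 -> q i != 0.
Proof.
move=> KLy i pi0; apply: contraTneq KLy => qi0.
rewrite /KL_div (bigD1 i)//= (negbTE pi0) qi0 eqxx addye ?ltxx//.
apply/negP => /eqP/esum_eqNyP[k [_ _]].
by case: ifP => // _; case: ifP.
Qed.

Lemma weak_duality z p q r beta : distributions p -> distributions q ->
  (KL_div p q <= r%:E)%E -> (forall i, z i <= beta) ->
  \sum_i q i * z i <= beta - expR (- r) * \prod_i (beta - z i) `^ p i.
Proof.
move=> dp [q_ge0 q1] KLr zb.
have p_ge0 := dp.1.
have pq := KL_div_lty (le_lt_trans KLr (ltry r)).
rewrite KL_div_fin// lee_fin in KLr.
have bz_ge0 i : 0 <= beta - z i by rewrite subr_ge0.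
have qp_ge0 i : 0 <= q i / p i by rewrite divr_ge0.
have qp_gt0 i : p i != 0 -> 0 < q i / p i.
  by move=> pi0; rewrite divr_gt0// lt_neqAle eq_sym ?pi0 ?pq/=.
rewrite lerBrDl -lerBrDr.
have -> : beta - \sum_i q i * z i = \sum_i q i * (beta - z i).
  by under [RHS]eq_bigr do rewrite mulrBr; rewrite sumrB -mulr_suml q1 mul1r.
(* This product factors: the powers of [q i / p i] multiply to at least [expR (- r)] by the
   divergence bound. *)
apply: (@le_trans _ _ (\prod_i (q i / p i * (beta - z i)) `^ p i)).
  under [leRHS]eq_bigr do rewrite powRM//.
  rewrite big_split/= ler_wpM2r//; first by apply: prodr_ge0 => i _; exact: powR_ge0.
  rewrite prod_powR// ler_expR lerNl (le_trans _ KLr)//.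
  rewrite -sumrN ler_sum// => i _; rewrite -mulrN.
  have [->|pi0] := eqVneq (p i) 0; first by rewrite !mul0r.
  by rewrite -lnV ?posrE ?qp_gt0// invf_div.
apply: le_trans (weighted_AMGM dp _) _; first by move=> i; exact: mulr_ge0.
(* Mass of [q] outside the support of [p] only enlarges the right-hand side. *)
apply: ler_sum => i _; have [->|pi0] := eqVneq (p i) 0.
  by rewrite mul0r mulr_ge0.
by rewrite mulrA [p i * _]mulrC divfK.
Qed.

(* The exponential of the divergence of p from the distribution proportional to
   p i / (beta - z i). *)
Definition tilt z p beta :=
  expR (\sum_i p i * ln (beta - z i)) * \sum_i p i / (beta - z i).

(* The last hypothesis is complementary slackness: either the divergence constraint
   is tight, or beta = z m and m receives the mass missing from the tilted weights. *)
Lemma tilted_distribution z p r beta m : distributions p ->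
  (forall i, z i <= beta) -> (forall i, p i != 0 -> z i < beta) ->
  tilt z p beta <= expR r -> (tilt z p beta - expR r) * (beta - z m) = 0 ->
  exists q, [/\ distributions q, (KL_div p q <= r%:E)%E &
    \sum_i q i * z i = beta - expR (- r) * \prod_i (beta - z i) `^ p i].
Proof.
move=> [p_ge0 p1] zb zb_lt Fr Fm.
have bz_gt0 i : p i != 0 -> 0 < beta - z i by move/zb_lt; rewrite subr_gt0.
rewrite prod_powR//; set L := \sum_i p i * ln _; rewrite -expRD.
set c := expR _; have c_gt0 : 0 < c by exact: expR_gt0.
(* [W] is the total mass of the weights [w] below; the deficit [1 - W] will be placed at [m]. *)
pose W := c * \sum_i p i / (beta - z i).
have WE : W = tilt z p beta / expR r by rewrite /W /c /tilt expRD expRN -/L; ring.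
have W_le1 : W <= 1 by rewrite WE ler_pdivrMr ?expR_gt0// mul1r.
have Wm : (1 - W) * (beta - z m) = 0.
  have e0 : expR r != 0 by rewrite gt_eqF ?expR_gt0.
  rewrite (_ : 1 - W = - (tilt z p beta - expR r) / expR r).
    by rewrite mulrAC mulNr Fm oppr0 mul0r.
  by rewrite WE opprB mulrBl divff.
pose w i := c * (p i / (beta - z i)).
have w_ge0 i : 0 <= w i.
  by rewrite mulr_ge0 ?(ltW c_gt0)// divr_ge0// subr_ge0.
pose q i := w i + (1 - W) * (i == m)%:R.
have qw i : w i <= q i by rewrite lerDl mulr_ge0// subr_ge0.
have q_gt0 i : p i != 0 -> 0 < q i.
  move=> pi0; apply: lt_le_trans (qw i).
  by rewrite mulr_gt0// divr_gt0 ?bz_gt0// lt_neqAle eq_sym pi0 p_ge0.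
have delta_sum (f : S -> R) : \sum_i (1 - W) * (i == m)%:R * f i = (1 - W) * f m.
  rewrite (bigD1 m)//= eqxx mulr1 big1 ?addr0// => i /negbTE->.
  by rewrite mulr0 mul0r.
have q1 : \sum_i q i = 1.
  rewrite big_split/= -mulr_sumr -/W.
  rewrite -[in RHS](subrKC W 1) -[1 - W in RHS]mulr1 -(delta_sum (fun=> 1)).
  by congr (_ + _); apply: eq_bigr => i _; rewrite mulr1.
exists q; split.
- by split => // i; exact: le_trans (w_ge0 i) (qw i).
- rewrite KL_div_fin; last by move=> i /q_gt0/gt_eqF->.
  (* On the support, [w i <= q i] gives [p i / q i <= (beta - z i) / c]; the resulting bound sums to
     exactly [r]. *)
  rewrite lee_fin (@le_trans _ _ (\sum_i p i * (ln (beta - z i) - ln c)))//.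
    apply: ler_sum => i _; have [->|pi0] := eqVneq (p i) 0; first by rewrite !mul0r.
    have pi_gt0 : 0 < p i by rewrite lt_neqAle eq_sym pi0 p_ge0.
    rewrite ler_wpM2l// -ln_div ?posrE ?bz_gt0// ler_ln ?posrE ?divr_gt0 ?q_gt0 ?bz_gt0//.
    rewrite ler_pdivrMr ?q_gt0// mulrAC ler_pdivlMr//.
    have := qw i; rewrite -(ler_pM2l (bz_gt0 _ pi0)); apply: le_trans.
    by rewrite /w mulrCA [_ * (p i / _)]mulrC divfK ?gt_eqF ?bz_gt0// mulrC.
  under eq_bigr do rewrite mulrBr.
  by rewrite sumrB -mulr_suml p1 /c expRK -/L; lra.
- have -> : \sum_i q i * z i = beta - \sum_i q i * (beta - z i).
    under [in RHS]eq_bigr do rewrite mulrBr.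
    by rewrite sumrB -mulr_suml q1 mul1r opprB subrKC.
  (* The extra mass at [m] costs nothing by [Wm], and [w i * (beta - z i) = c * p i]. *)
  congr (_ - _); under eq_bigr do rewrite mulrDl.
  rewrite big_split/= delta_sum Wm addr0 -[RHS]mulr1 -p1 mulr_sumr.
  apply: eq_bigr => i _; have [pi0|pi0] := eqVneq (p i) 0.
    by rewrite /w pi0 mul0r !mulr0 mul0r.
  by rewrite /w -mulrA divfK ?gt_eqF ?bz_gt0.
Qed.

(** Terms with [p i = 0] are identically zero, so continuity survives at [beta = z i] for such [i].
    This allows the search for [beta] to start at the largest [z i] when it was never observed. *)
Lemma tilt_continuous z p beta : (forall i, p i != 0 -> z i < beta) ->
  {for beta, continuous (tilt z p)}.
Proof.
move=> zb; rewrite /tilt.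
have bz_gt0 i : p i != 0 -> 0 < beta - z i by move/zb; rewrite subr_gt0.
have cB i : {for beta, continuous (fun x : R => x - z i)}.
  by apply: cvgB; [exact: cvg_id|exact: cvg_cst].
apply: cvgM.
  apply: continuous_comp; last exact: continuous_expR.
  apply: cvg_big => [|i _]; first exact: add_continuous.
  have [->|pi0] := eqVneq (p i) 0.
    by under eq_fun do rewrite mul0r; rewrite mul0r; exact: cvg_cst.
  apply: cvgM; first exact: cvg_cst.
  by apply: continuous_comp (cB i) _; apply: continuous_ln; exact: bz_gt0.
apply: cvg_big => [|i _]; first exact: add_continuous.
  have [->|pi0] := eqVneq (p i) 0.
  by under eq_fun do rewrite mul0r; rewrite mul0r; exact: cvg_cst.
apply: cvgM; first exact: cvg_cst.
by apply: cvgV; [rewrite gt_eqF// bz_gt0|exact: cB].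
Qed.

Lemma tilt_IVT z p r a b : a <= b -> (forall i, p i != 0 -> z i < a) ->
  expR r <= tilt z p a -> tilt z p b <= expR r ->
  exists2 beta, a <= beta & tilt z p beta = expR r.
Proof.
move=> ab za Fa Fb.
have cF : {within `[a, b], continuous (tilt z p)}.
  apply: continuous_in_subspaceT => x; rewrite inE/= in_itv/= => /andP[ax _].
  by apply: tilt_continuous => i /za /lt_le_trans; apply.
have [|beta] := @IVT R (tilt z p) a b (expR r) ab cF.
  by rewrite ge_min le_max Fa Fb orbT.
by rewrite in_itv/= => /andP[ab' _] <-; exists beta.
Qed.

(** For [l] below and [a] above all the [z i], AM-GM bounds the tilt by [(b - l) / (b - a)], which
    tends to 1 < [expR r]. *)
Lemma tilt_upper z p r a : distributions p -> 0 < r -> (forall i, z i <= a) ->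
  exists2 b, a + 1 <= b & tilt z p b <= expR r.
Proof.
move=> dp r_gt0 za; have [p_ge0 p1] := dp.
pose l := - \sum_i `|z i|.
have lz i : l <= z i.
  rewrite /l lerNl (le_trans (ler_norm _))// normrN (bigD1 i)//= lerDl.
  exact: sumr_ge0.
have e_gt0 : 0 < expR r - 1 by rewrite subr_gt0 expR_gt1.
have [i0 _] := distribution_neq0 dp.
have la : l <= a by exact: le_trans (lz i0) (za i0).
(* The fraction alone would solve [b - l = expR r * (b - a)]; the added 1 keeps [b] away from
   [a]. *)
exists (a + 1 + (a - l) / (expR r - 1)).
  by rewrite lerDl divr_ge0 ?(ltW e_gt0) ?subr_ge0.
set b := _ + _ / _.
have baE : b - a = 1 + (a - l) / (expR r - 1) by rewrite /b; ring.
have ba_gt0 : 0 < b - a.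
  by rewrite baE ltr_wpDr// divr_ge0 ?(ltW e_gt0) ?subr_ge0.
have ab : a < b by rewrite -subr_gt0.
have zb i : z i < b by rewrite (le_lt_trans (za i))// -subr_gt0.
have bl : b - l <= expR r * (b - a).
  rewrite -subr_ge0 (_ : _ - _ = (expR r - 1) * (b - a) - (a - l)); last by ring.
  by rewrite baE mulrDr mulr1 [_ * (_ / _)]mulrC divfK ?gt_eqF// addrK ltW.
rewrite /tilt -prod_powR; last by move=> i _; rewrite subr_gt0.
apply: (@le_trans _ _ ((b - l) * (b - a)^-1)); last by rewrite ler_pdivrMr.
apply: ler_pM.
- by apply: prodr_ge0 => i _; exact: powR_ge0.
- by apply: sumr_ge0 => i _; rewrite divr_ge0// subr_ge0 ltW.
- apply: le_trans (weighted_AMGM dp _) _; first by move=> i; rewrite subr_ge0 ltW.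
  apply: (@le_trans _ _ (\sum_i p i * (b - l))); last by rewrite -mulr_suml p1 mul1r.
  by apply: ler_sum => i _; rewrite ler_wpM2l// lerD2l lerN2.
- apply: (@le_trans _ _ (\sum_i p i * (b - a)^-1)); last by rewrite -mulr_suml p1 mul1r.
  apply: ler_sum => i _; rewrite ler_wpM2l// lef_pV2 ?posrE ?subr_gt0//.
  by rewrite lerD2l lerN2.
Qed.

(** At distance [eps] above [z m], the sum in the tilt is at least [p m / eps], while its
    exponential factor decays only like [eps] to the power [p m < 1]; so the tilt blows up. *)
Lemma tilt_lower z p r m : distributions p -> 0 < r -> 0 < p m < 1 ->
  (forall i, i != m -> z i < z m) ->
  exists2 a, z m < a <= z m + 1 & expR r <= tilt z p a.
Proof.
move=> [p_ge0 p1] r_gt0 /andP[pm_gt0 pm_lt1] zm.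
(* The gap below [z m], capped at 1 so that the witness stays within [z m + 1]. *)
pose delta := \big[Num.min/1]_(i | i != m) (z m - z i).
have delta_le1 : delta <= 1 by exact: bigmin_le_id.
have delta_gt0 : 0 < delta by apply: lt_bigmin => // i /zm; rewrite subr_gt0.
have delta_le i : i != m -> delta <= z m - z i.
  by move=> im; exact: bigmin_le_cond.
(* The mass at m makes the tilt grow like (delta / eps) ^ (1 - p m). *)
pose eps := expR (ln delta - (r - ln (p m)) / (1 - p m)).
have eps_gt0 : 0 < eps by exact: expR_gt0.
have pm1 : 0 < 1 - p m by rewrite subr_gt0.
have eps_le : eps <= delta.
  rewrite -[leRHS]lnK ?posrE// ler_expR gerBl divr_ge0 ?(ltW pm1)//.
  by rewrite subr_ge0 (le_trans (ln_le0 (ltW pm_lt1)) (ltW r_gt0)).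
exists (z m + eps); first by rewrite ltrDl eps_gt0 lerD2l (le_trans eps_le).
set a := z m + eps.
have az_ge i : i != m -> delta <= a - z i.
  by move=> /delta_le; rewrite /a; lra.
have az_gt0 i : 0 < a - z i.
  have [->|/az_ge] := eqVneq i m; first by rewrite /a [z m + _]addrC addrK.
  exact: lt_le_trans.
have amE : a - z m = eps by rewrite /a [z m + _]addrC addrK.
have p1m : \sum_(i | i != m) p i = 1 - p m by rewrite -p1 [in RHS](bigD1 m)//= [p m + _]addrC addrK.
(* [eps] was chosen to make this lower bound equal to [expR r]. *)
apply: (@le_trans _ _ (expR (p m * ln eps + (1 - p m) * ln delta) * (p m / eps))).
  have -> : p m / eps = expR (ln (p m) - ln eps).
    by rewrite expRD expRN !lnK ?posrE.
  rewrite -expRD ler_expR /eps expRK.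
  set k := (r - _) / _.
  have kE : k * (1 - p m) = r - ln (p m) by rewrite /k divfK ?gt_eqF.
  rewrite (_ : _ + _ = k * (1 - p m) + ln (p m)); last by ring.
  by rewrite kE subrK.
apply: ler_pM; first exact: expR_ge0.
- by rewrite divr_ge0 ?ltW.
- rewrite ler_expR (bigD1 m)//= amE lerD2l -p1m mulr_suml.
  by apply: ler_sum => i im; rewrite ler_wpM2l// ler_ln ?posrE ?az_ge.
- rewrite (bigD1 m)//= amE lerDl sumr_ge0// => i _.
  by rewrite divr_ge0// ltW.
Qed.

Lemma strong_duality z p r : injective z -> distributions p -> 0 < r ->
  exists beta, (forall i, z i <= beta) /\
    exists q, [/\ distributions q, (KL_div p q <= r%:E)%E &
      \sum_i q i * z i = beta - expR (- r) * \prod_i (beta - z i) `^ p i].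
Proof.
move=> z_inj dp r_gt0; have [p_ge0 p1] := dp.
have [i0 _] := distribution_neq0 dp.
have [m zm] : exists m, forall i, z i <= z m.
  by case: (@arg_maxP _ _ _ i0 xpredT z) => // m _ zm; exists m => i; exact: zm.
have zm_lt i : i != m -> z i < z m.
  by move=> im; rewrite lt_neqAle zm andbT (inj_eq z_inj).
have p1m : \sum_(i | i != m) p i = 1 - p m by rewrite -p1 [in RHS](bigD1 m)//= [p m + _]addrC addrK.
(* If all mass is at [m], the tilt is constantly 1 beyond [z m] and never tight; [p] itself is
   optimal. *)
have [pm1|pmN1] := eqVneq (p m) 1.
  have p0 i : i != m -> p i = 0.
    move=> im; move/eqP: p1m; rewrite pm1 subrr psumr_eq0// => /allP/(_ i).
    by rewrite mem_index_enum im => /(_ isT)/eqP.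
  exists (z m); split => //; exists p; split => //.
  - rewrite KL_div_fin// big1 ?lee_fin ?ltW// => i _.
    have [->|pi0] := eqVneq (p i) 0; first by rewrite mul0r.
    by rewrite divff// ln1 mulr0.
  - rewrite (bigD1 m)//= [X in _ + X]big1 => [|i /p0->]; last by rewrite mul0r.
    rewrite [\prod_i _](bigD1 m)//= subrr pm1 powR0 ?oner_eq0//.
    by rewrite mul0r mulr0 subr0 mul1r addr0.
have pm_lt1 : p m < 1.
  rewrite lt_neqAle pmN1/= -subr_ge0 -p1m; exact: sumr_ge0.
(* Left end of the search: [z m] itself if [p m = 0], otherwise a point near the pole where the tilt
   already reaches [expR r]. *)
have [a [/andP[zma az1] za aP]] : exists a, [/\ z m <= a <= z m + 1,
    forall i, p i != 0 -> z i < a & expR r <= tilt z p a \/ a = z m].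
  have [pm0|pm0] := eqVneq (p m) 0.
    exists (z m); split; [by rewrite lexx lerDl ler01|move=> i|by right].
    by have [->|im _] := eqVneq i m; [rewrite pm0 eqxx|exact: zm_lt].
  have [|a /andP[zma az1] Fa] := tilt_lower dp r_gt0 _ zm_lt.
    by rewrite pm_lt1 lt_neqAle eq_sym pm0 p_ge0.
  exists a; split; [by rewrite (ltW zma)|move=> i _|by left].
  exact: le_lt_trans zma.
have [Fa|/ltW Fa] := leP (expR r) (tilt z p a).
  have [b bz Fb] := tilt_upper dp r_gt0 zm.
  have [beta ab Fbeta] := tilt_IVT (le_trans az1 bz) za Fa Fb.
  have zbeta i : z i <= beta by exact: le_trans (zm i) (le_trans zma ab).
  exists beta; split => //; apply: (@tilted_distribution z p r beta m) => //.
  - by move=> i /za /lt_le_trans; apply.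
  - by rewrite Fbeta.
  - by rewrite Fbeta subrr mul0r.
(* The tilt at [a] is at most [expR r]: either [a = z m] and [m] absorbs the slack, or the
   constraint is tight at [a]. *)
have [aE|Fa'] : a = z m \/ tilt z p a = expR r.
  by case: aP => [Fa'|]; [right; apply/eqP; rewrite eq_le Fa|left].
  rewrite aE in za Fa *.
  exists (z m); split => //; apply: (@tilted_distribution z p r _ m) => //.
  by rewrite subrr mulr0.
have zaa i : z i <= a by exact: le_trans (zm i) zma.
exists a; split => //; apply: (@tilted_distribution z p r _ m) => //.
by rewrite Fa' subrr mul0r.
Qed.

End OneDimensionalDuality.

(** * Attained extrema, and joint distributions with given marginals *)

Lemma is_max_sup {R : realType} (E : set R) v : is_max E v -> sup E = v.
Proof.
move=> [Ev ubv]; apply/eqP; rewrite eq_le ge_sup//=; last by exists v.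
by apply: ub_le_sup => //; exists v.
Qed.

Lemma is_min_inf {R : realType} (E : set R) v : is_min E v -> inf E = v.
Proof.
move=> [Ev lbv]; apply/eqP; rewrite eq_le lb_le_inf ?andbT//; last by exists v.
by apply: ge_inf => //; exists v.
Qed.

(** Distributivity of products over sums for a dependent family, transported along the bijection
    with [fprod]. It yields the total mass and the marginals of a product distribution. *)
Lemma sum_dffun_prod {R : realType} (I : finType) (S_ : I -> finType)
    (f : forall a, S_ a -> R) :
  \sum_(s : {dffun forall a, S_ a}) \prod_a f a (s a) =
  \prod_a \sum_(i : S_ a) f a i.
Proof.
rewrite (reindex (@dffun_of_fprod I S_)) /=; last first.
  exact/onW_bij/dffun_of_fprod_bij.
under eq_bigr => t _ do under eq_bigr => a _ do rewrite ffunE -(ffunE (f a)).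
rewrite (big_fprod 1 _ (fun a => finfun (f a))).
under [RHS]eq_bigr => a _.
  rewrite (eq_bigr (finfun (f a))); last by move=> i _; rewrite ffunE.
  by rewrite (big_tag (fun b => finfun (f b)) a) over.
by rewrite (bigA_distr_big_dep (fun a => tagged_with S_ a)).
Qed.

Section JointDistributions.
Context {R : realType} {n : nat} {d : 'I_n -> nat}.
Variable z : forall a : 'I_n, 'I_(d a) -> R.
Arguments z : clear implicits.

Lemma expected_cost_marginal (Q : @scenario n d -> R) (x : 'cV[R]_n) :
  expected_cost z Q x = \sum_(a < n) (\sum_i @marginal R n d Q a i * z a i) * x a 0.
Proof.
rewrite /expected_cost; under eq_bigr do rewrite mulr_sumr.
rewrite exchange_big; apply: eq_bigr => a _ /=.
rewrite (partition_big (fun s : scenario => s a) xpredT)//= mulr_suml.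
apply: eq_bigr => i _; rewrite /marginal !mulr_suml.
by apply: eq_bigr => s /eqP->; rewrite mulrA.
Qed.

Definition product_distribution (q : forall a, 'I_(d a) -> R) :
  @scenario n d -> R := fun s => \prod_a q a (s a).

Lemma marginal_product (q : forall a, 'I_(d a) -> R) a :
  (forall b, distributions (q b)) ->
  @marginal R n d (product_distribution q) a = q a.
Proof.
move=> dq; apply/funext => i; rewrite /marginal big_mkcond/=.
(* The event on coordinate [a] is absorbed into its factor. Indices are compared in [nat] because
   [j] and [i] have different types in general. *)
pose f b (j : 'I_(d b)) := if (b == a) ==> (j == i :> nat) then q b j else 0.
have fE (s : scenario) :
    (if s a == i then product_distribution q s else 0) = \prod_b f b (s b).
  case: ifPn => si; last first.
    by rewrite (bigD1 a)//= /f eqxx/= -[_ == _ :> nat]/(s a == i) (negbTE si) mul0r.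
  apply: eq_bigr => b _; rewrite /f.
  by case: eqVneq => //= ba; rewrite (_ : _ == _)//; subst b.
under eq_bigr => s _ do rewrite fE.
rewrite sum_dffun_prod (bigD1 a)//= [X in _ * X]big1 => [|b ba].
  rewrite mulr1 (bigD1 i)//= /f !eqxx/= big1 ?addr0// => j ji.
  by rewrite -[_ == _ :> nat]/(j == i) (negbTE ji).
by rewrite /f (negbTE ba)/=; exact: (dq b).2.
Qed.

Lemma product_distributionP (q : forall a, 'I_(d a) -> R) :
  (forall b, distributions (q b)) -> distributions (product_distribution q).
Proof.
move=> dq; split=> [s|]; first by apply: prodr_ge0 => b _; exact: (dq b).1.
by rewrite sum_dffun_prod big1// => b _; exact: (dq b).2.
Qed.

End JointDistributions.

(** * Worst-case cost over the ambiguity set *)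

Section AmbiguitySet.
Context {R : realType} {n : nat} {d : 'I_n -> nat}.
Variable z : forall a : 'I_n, 'I_(d a) -> R.
Variables (T : 'I_n -> nat) (chat : forall a : 'I_n, 'I_(T a) -> R).
Variable r : 'I_n -> R.
Arguments z : clear implicits.
Arguments chat : clear implicits.
Hypothesis z_inj : forall a, injective (z a).
Hypothesis z_gt0 : forall a i, 0 < z a i.
Hypothesis T_gt0 : forall a, (0 < T a)%N.
Hypothesis chat_in : forall a j, exists i, chat a j = z a i.
Hypothesis r_gt0 : forall a, 0 < r a.

(** Each observation is counted exactly once: at least once by [chat_in], at most once by
    [z_inj]. *)
Lemma empirical_distribution a : distributions (@empirical R n d z T chat a).
Proof.
split=> [i|]; first by rewrite /empirical divr_ge0.
rewrite -mulr_suml -natr_sum.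
rewrite (_ : (\sum_i _)%N = T a) ?divff// ?pnatr_eq0 -?lt0n//.
under eq_bigr do rewrite -sum1_card big_mkcond/=.
rewrite exchange_big/= -[RHS]card_ord -sum1_card; apply: eq_bigr => j _.
have [i ji] := chat_in j; rewrite (bigD1 i)//= inE ji eqxx big1// => k ki.
by rewrite inE ji (inj_eq (@z_inj a)) eq_sym (negbTE ki).
Qed.

Lemma zbar_leP a (beta : R) :
  reflect (forall i, z a i <= beta) (zbar z a <= beta).
Proof.
apply: (iffP idP) => [zb i|zb]; first by rewrite (le_trans _ zb)// le_bigmax.
(* The nonempty sample provides a support point [z a j > 0], so [beta] also dominates the default 0
   of [zbar]. *)
have [j _] := chat_in (Ordinal (T_gt0 a)).
by apply: bigmax_le => // ; exact: le_trans (ltW (z_gt0 j)) (zb j).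
Qed.

(** One pair [beta], [q] with equal values certifies both optima through weak duality. *)
Lemma marginal_duality a : exists v, is_min (dual_values z chat r a) v /\
  is_max [set \sum_i q i * z a i | q in @marginal_ambiguity_set R n d z T chat r a] v.
Proof.
have dp := empirical_distribution a.
have [beta [zbeta [q [dq KLq qE]]]] := strong_duality (@z_inj a) dp (r_gt0 a).
exists (\sum_i q i * z a i); split; split.
- by exists beta => //; exact/zbar_leP.
- move=> _ [b /zbar_leP zb <-]; exact: weak_duality dp dq KLq zb.
- by exists q.
- move=> _ [q' [dq' KLq'] <-]; rewrite qE; exact: weak_duality dp dq' KLq' zbeta.
Qed.

Lemma dual_minP a : is_min (dual_values z chat r a) (dual_min z chat r a).
Proof.
by have [v [vmin _]] := marginal_duality a; rewrite /dual_min (is_min_inf vmin).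
Qed.

Lemma worst_case_costP (x : 'cV[R]_n) : (forall a, 0 <= x a 0) ->
  is_max (expected_costs z chat r x) (reformulated_cost z chat r x).
Proof.
move=> x_ge0.
have mdual a : is_max [set \sum_i q i * z a i |
    q in @marginal_ambiguity_set R n d z T chat r a] (dual_min z chat r a).
  have [v [vmin vmax]] := marginal_duality a.
  by rewrite /dual_min (is_min_inf vmin).
split=> [|_ [Q [dQ mQ] <-]].
  have q_ a : {q | @marginal_ambiguity_set R n d z T chat r a q /\
      \sum_i q i * z a i = dual_min z chat r a}.
    by apply: cid; have [[q mq qE] _] := mdual a; exists q.
  pose q a := projT1 (q_ a).
  have dq a : distributions (q a) by have [[]] := projT2 (q_ a).
  exists (product_distribution q).
    split; first exact: product_distributionP.
    by move=> a; rewrite marginal_product//; have [] := projT2 (q_ a).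
  rewrite expected_cost_marginal; apply: eq_bigr => a _.
  by rewrite marginal_product//; have [_ ->] := projT2 (q_ a).
rewrite expected_cost_marginal; apply: ler_sum => a _; rewrite ler_wpM2r//.
by apply: (mdual a).2; exists (@marginal R n d Q a).
Qed.

End AmbiguitySet.

(** * Compactness of the feasible set and attainment of the minimum *)

Lemma closed_int {R : realType} : closed [set x : R | x \is a Num.int].
Proof.
rewrite -[X in closed X]setCK; apply: open_closedC; rewrite openE => x /negP xNint.
(* The open interval between consecutive integers around [x] contains no integer. *)
have xfloor : x \in `](Num.floor x)%:~R, (Num.floor x + 1)%:~R[.
  rewrite in_itv/= floorD1_gt andbT lt_neqAle floor_le andbT.
  by rewrite -intrEfloor.
apply: filterS (near_in_itvoo xfloor) => y.
rewrite in_itv/= => /andP[xy yx] /intrP[k yk]; move: xy yx.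
by rewrite yk !ltr_int ltzD1 leNgt => ->.
Qed.

Section LinearMinimization.
Context {R : realType} {n1 n2 m : nat}.
Variables (A : 'M[R]_(m, n1 + n2)) (b : 'cV[R]_m) (u : 'cV[R]_(n1 + n2)).
Let X := mixed_integer_set (n1 := n1) A b.

Lemma linear_form_continuous (c : 'I_(n1 + n2) -> R) :
  continuous (fun v : 'rV[R]_(n1 + n2) => \sum_a c a * v 0 a).
Proof.
apply: continuous_big => [|a _ v]; first exact: add_continuous.
exact: (continuous_comp (@coord_continuous R _ _ 0 a v) (@mulrl_continuous R (c a) _)).
Qed.

(* Transposed because the library proves compactness of boxes for row vectors. *)
Lemma closed_mixed_integer_set : closed [set v : 'rV[R]_(n1 + n2) | X v^T].
Proof.
rewrite (_ : mkset _ =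
  (\bigcap_i ((fun v : 'rV_(n1 + n2) => v 0 (lshift n2 i)) @^-1` [set t | t \is a Num.int])) `&`
  (\bigcap_k ((fun v : 'rV_(n1 + n2) => \sum_a A k a * v 0 a) @^-1` [set t | t <= b k 0]))).
  apply: closedI; apply: closed_bigI => i _; apply: preimage_closed.
  - by move=> v _; exact: coord_continuous.
  - exact: closed_int.
  - by move=> v _; exact: linear_form_continuous.
  - exact: closed_le.
have rowE (v : 'rV[R]_(n1 + n2)) k : (A *m v^T) k 0 = \sum_a A k a * v 0 a.
  by rewrite mxE; apply: eq_bigr => a _; rewrite mxE.
apply/seteqP; split=> v; rewrite /X /mixed_integer_set /=.
- move=> [vint vle]; split=> [i _|k _] /=; first by have := vint i; rewrite mxE.
  by rewrite -rowE; exact: vle.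
- move=> [vint vle]; split=> [i|k]; first by rewrite mxE; exact: vint.
  by rewrite rowE; exact: vle.
Qed.

Hypothesis X_nonempty : X !=set0.
Hypothesis X_bounded : forall x, X x -> forall a, 0 <= x a 0 <= u a 0.

(** The bounds enclose the closed feasible set in a compact box, so the extreme value theorem
    applies. *)
Lemma linear_min_attained (c : 'I_(n1 + n2) -> R) :
  exists2 x, X x & forall y, X y -> \sum_a c a * x a 0 <= \sum_a c a * y a 0.
Proof.
pose Xt := [set v : 'rV[R]_(n1 + n2) | X v^T].
have Xt0 : Xt !=set0 by have [x Xx] := X_nonempty; exists x^T; rewrite /Xt/= trmxK.
have Xt_compact : compact Xt.
  have box_compact := @rV_compact R _ (fun a => [set` `[0, u a 0]])
    (fun a => @segment_compact R 0 (u a 0)).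
  apply: subclosed_compact closed_mixed_integer_set box_compact _.
  by move=> v /= Xv a; have := X_bounded Xv a; rewrite mxE in_itv.
have [|v Xv vmin] := @compact_EVT_min _ R (fun v : 'rV[R]_(n1 + n2) => \sum_a c a * v 0 a) Xt Xt0 Xt_compact.
  by apply: continuous_subspaceT; exact: linear_form_continuous.
exists v^T; first by rewrite inE in Xv.
move=> y Xy; under eq_bigr do rewrite mxE.
have := vmin y^T; rewrite inE /Xt/= trmxK => /(_ Xy).
by under [leRHS]eq_bigr do rewrite mxE.
Qed.

End LinearMinimization.

Theorem proposition1 (R : realType) (n1 n2 m : nat)
    (A : 'M[R]_(m, n1 + n2)) (b : 'cV[R]_m) (u : 'cV[R]_(n1 + n2))
    (d : 'I_(n1 + n2) -> nat) (z : forall a : 'I_(n1 + n2), 'I_(d a) -> R)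
    (T : 'I_(n1 + n2) -> nat) (chat : forall a : 'I_(n1 + n2), 'I_(T a) -> R)
    (r : 'I_(n1 + n2) -> R)
    (X := mixed_integer_set A b)
    (X_nonempty : X !=set0)
    (X_not0 : ~ X 0)
    (u_ge0 : forall a, 0 <= u a 0)
    (X_bounded : forall x, X x -> forall a, 0 <= x a 0 <= u a 0)
    (z_inj : forall a, injective (z a))
    (z_gt0 : forall a i, 0 < z a i)
    (T_gt0 : forall a, (0 < T a)%N)
    (chat_in : forall a j, exists i, chat a j = z a i)
    (r_gt0 : forall a, 0 < r a) :
  [/\ forall x, X x ->
        is_max (expected_costs z chat r x) (worst_case_cost z chat r x),
      forall a, is_min (dual_values z chat r a) (dual_min z chat r a),
      exists v, is_min (worst_case_cost z chat r @` X) v /\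
                is_min (reformulated_cost z chat r @` X) v
    & argmin X (worst_case_cost z chat r) =
      argmin X (reformulated_cost z chat r)].
Proof.
have maxX x : X x ->
    is_max (expected_costs z chat r x) (reformulated_cost z chat r x).
  move=> Xx; apply: worst_case_costP => // a.
  by have /andP[] := X_bounded x Xx a.
(* The two objectives agree pointwise on [X], hence so do their minima and minimizers. *)
have wcE x : X x -> worst_case_cost z chat r x = reformulated_cost z chat r x.
  by move=> /maxX /is_max_sup.
split=> [x Xx|a||].
- by rewrite wcE//; exact: maxX.
- exact: dual_minP.
- have [x Xx xmin] := linear_min_attained X_nonempty X_bounded (dual_min z chat r).
  exists (reformulated_cost z chat r x); split; split.
  + by exists x => //; exact: wcE.
  + by move=> _ [y Xy <-]; rewrite wcE//; exact: xmin.
  + by exists x.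
  + by move=> _ [y Xy <-]; exact: xmin.
- apply/seteqP; split=> x [Xx xmin]; split=> // y Xy.
  + by rewrite -!wcE//; exact: xmin.
  + by rewrite !wcE//; exact: xmin.
Qed.
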